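(* Let $G$ be a plane graph in which every $3$-face is adjacent to at most two $3$-faces, and suppose $\delta(G)\geq 5$. Then $G$ contains a diamond whose four vertices consist of three vertices of degree $5$ (in $G$) and one vertex of degree at most $6$ (in $G$).
   Context: All graphs are finite and simple; $\delta(G)$ is the minimum degree. In a plane graph, a $k$-face is a face of length $k$ (length = number of edges on its boundary walk, a cut edge counted twice); two faces are adjacent if they share an edge. A diamond is a configuration of two adjacent $3$-faces sharing exactly one edge (the mid-edge), so it has four vertices; the mid-edge may be incident to any of the vertices. *)

(* Defs.v *)
From mathcomp Require Import all_boot all_fingroup.

Set Implicit Arguments.
Unset Strict Implicit.
Unset Printing Implicit Defensive.

Record sgraph := SGraph {
  vertex :> finType;
  adj : rel vertex;
  adj_sym : symmetric adj;
  adj_irrefl : irreflexive adj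
}.

Definition degree (G : sgraph) (v : G) : nat := #|[set w | adj v w]|.

(* The unit #|G| exceeds every degree, so it never affects the minimum of a
   nonempty graph; the empty graph gets minimum degree 0. *)
Definition min_degree (G : sgraph) : nat := \big[minn/#|G|]_(v : G) degree v.

(* A dart is an edge with a direction. *)
Definition darts (G : sgraph) : {set G * G} := [set d | adj d.1 d.2].

Definition edges (G : sgraph) : {set {set G}} :=
  [set [set d.1; d.2] | d in darts G].

Definition isolated (G : sgraph) : {set G} := [set v | degree v == 0].

Definition components (G : sgraph) : nat := n_comp (@adj G) predT.

(* Face tracing: after the dart (u, v), leave v along the edge that follows vu
   in the rotation at v. *)
Definition next_dart (G : sgraph) (rot : G -> {perm G}) (d : G * G) : G * G :=
  (d.2, rot d.2 d.1).

(* The facial walks are the orbits of face tracing on the darts, together with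
   one walk of length 0 for each isolated vertex. *)
Definition facial_walks (G : sgraph) (rot : G -> {perm G}) : nat :=
  fcard (next_dart rot) (mem (darts G)) + #|isolated G|.

Definition on_face (G : sgraph) (F : finType) (dart_face : G -> G -> F)
    (vertex_face : G -> F) (v : G) (f : F) : bool :=
  if v \in isolated G then vertex_face v == f
  else [exists w, adj v w && (dart_face v w == f)].

(* Two vertices are related when adjacent, a vertex and a face when incident;
   hence the connected components of G are the nodes on the vertex side of a
   bipartite graph "component / incident face". *)
Definition incidence (G : sgraph) (F : finType) (dart_face : G -> G -> F)
    (vertex_face : G -> F) : rel (G + F) :=
  fun x y => match x, y with
  | inl u, inl v => adj u v
  | inl v, inr f | inr f, inl v => on_face dart_face vertex_face v f
  | inr _, inr _ => false
  end.

(* A plane graph, possibly disconnected, given combinatorially, i.e., up to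
   orientation-preserving homeomorphism of the sphere; the outer face is a
   face like the others.
   - rot v restricts to the cyclic order of the neighbours around v; its values
     elsewhere are irrelevant.
   - dart_face u v is the face along the side of uv traced by the dart (u, v),
     so the two sides of the edge uv lie in dart_face u v and dart_face v u;
     vertex_face v is only relevant when v is isolated, and is then the face
     that contains v.
   - plane_genus0 is V - E + W = 2C with W facial walks and C components; since
     V - E + W <= 2 on each component of any rotation system, it says that
     every component has genus 0.
   - A face may be bounded by several facial walks, of distinct components. Each
     facial walk links its component to its face, and a family of spherical
     drawings fits together into one drawing on the sphere exactly when these
     W links form a tree on the C components and the F faces: this is
     plane_connected with plane_tree. *)
Record plane_graph := PlaneGraph {
  graph :> sgraph;
  rot : graph -> {perm graph};
  rot_cyclic : forall u v : graph,
    adj v u -> porbit (rot v) u = [set w | adj v w];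
  face : finType;
  dart_face : graph -> graph -> face;
  vertex_face : graph -> face;
  dart_face_next : forall u v : graph,
    adj u v -> dart_face v (rot v u) = dart_face u v;
  plane_genus0 :
    #|graph| + facial_walks rot = #|edges graph| + (components graph).*2;
  plane_connected : n_comp (incidence dart_face vertex_face) predT = 1;
  plane_tree : facial_walks rot + 1 = components graph + #|face|
}.

Section Faces.

Variable G : plane_graph.
Implicit Types f g : face G.

Definition boundary_darts f : {set G * G} :=
  [set d in darts G | dart_face d.1 d.2 == f].

Definition boundary_edges f : {set {set G}} :=
  [set [set d.1; d.2] | d in boundary_darts f].

(* An edge with f on both sides, i.e., a cut edge, contributes two darts. *)
Definition face_length f : nat := #|boundary_darts f|.

Definition kface (k : nat) f : bool := face_length f == k.

Definition common_edges f g : {set {set G}} :=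
  boundary_edges f :&: boundary_edges g.

Definition face_adj f g : bool := (f != g) && (common_edges f g != set0).

Definition diamond f g : bool :=
  [&& kface 3 f, kface 3 g, face_adj f g & #|common_edges f g| == 1].

Definition diamond_vertices f g : {set G} :=
  cover (boundary_edges f :|: boundary_edges g).

End Faces.

(* Main.v *)
(** Let A be the number of darts, V the number of vertices, T the number of
    3-faces and M the number of darts that have a 3-face on both sides (twice
    the number of diamonds).
    - Euler's formula, every other face having length at least 4, gives
      A < 4 V + T.
    - Reversal sends the 3 T - M remaining darts of 3-faces to darts that are
      not on a 3-face, so 6 T - M <= A.
    - At most two sides of each 3-face are mid-edges, so M <= 2 T.
    - Give a vertex the weight 0, 1 or 2 when its degree is 5, 6 or at least 7.
      If no diamond is as wanted, each has total weight at least 2. A vertex of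
      degree k belongs to at most k diamonds: the diamonds in which it is an end
      of the mid-edge, and those in which it is not, can be charged to distinct
      darts leaving it. Hence M is at most the sum over the vertices of weight
      times degree, which is at most 8 A - 40 V.
    The four inequalities are incompatible. *)

Require Import Defs.
From mathcomp Require Import all_boot all_fingroup.
From mathcomp Require Import zify.

Set Implicit Arguments.
Unset Strict Implicit.
Unset Printing Implicit Defensive.

Lemma leq_bigminn (I : eqType) (r : seq I) (x m : nat) (F : I -> nat) :
  m <= \big[minn/x]_(i <- r) F i -> m <= x /\ {in r, forall i, m <= F i}.
Proof.
elim: r => [|i r IHr]; first by rewrite big_nil; split.
rewrite big_cons leq_min => /andP[mFi /IHr[mx mF]]; split=> // j.
by rewrite inE => /predU1P[->|/mF].
Qed.

Definition rev_dart (T : Type) (d : T * T) : T * T := (d.2, d.1).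

Lemma rev_dartK (T : Type) : involutive (@rev_dart T).
Proof. by case. Qed.

Lemma rev_dart_inj (T : Type) : injective (@rev_dart T).
Proof. exact: inv_inj (@rev_dartK T). Qed.

(** * Darts, edges and degrees *)

Section Graph.

Variable G : sgraph.

Lemma mem_darts (d : G * G) : (d \in darts G) = adj d.1 d.2.
Proof. by rewrite inE. Qed.

Lemma mem_rev_darts (d : G * G) : (rev_dart d \in darts G) = (d \in darts G).
Proof. by rewrite !inE adj_sym. Qed.

Lemma sum_darts_source (F : G -> nat) :
  \sum_(d in darts G) F d.1 = \sum_v degree v * F v.
Proof.
under [RHS]eq_bigr => v _ do rewrite /degree -sum_nat_const.
rewrite pair_big_dep /=; apply: eq_bigl => d.
by rewrite !inE.
Qed.

Lemma card_darts : #|darts G| = \sum_(v : G) degree v.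
Proof.
rewrite -sum1_card (sum_darts_source (fun=> 1)).
by apply: eq_bigr => v _; rewrite muln1.
Qed.

Lemma set2_eq (T : finType) (a b c d : T) :
  [set a; b] = [set c; d] -> (a, b) = (c, d) \/ (a, b) = (d, c).
Proof.
move=> E.
have: a \in [set c; d] by rewrite -E set21.
have: b \in [set c; d] by rewrite -E set22.
have: c \in [set a; b] by rewrite E set21.
have: d \in [set a; b] by rewrite E set22.
rewrite !inE => /orP[] /eqP ? /orP[] /eqP ? /orP[] /eqP ? /orP[] /eqP ?; subst;
  by [left | right].
Qed.

Lemma card_darts_edges : #|darts G| = #|edges G|.*2.
Proof.
rewrite -sum1_card (partition_big_imset (fun d => [set d.1; d.2])) /=.
rewrite -muln2 -sum_nat_const; apply: eq_bigr => _ /imsetP[d dD ->].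
rewrite sum1_card (_ : #|_| = #|[set d; rev_dart d]|).
  rewrite cards2; case: eqP => // E; move: dD; rewrite mem_darts.
  by case: d E => a b [-> _]; rewrite adj_irrefl.
apply: eq_card => -[a b]; rewrite !inE; apply/andP/orP => [[_ /eqP]|].
  by move=> /set2_eq[] E; [left | right]; apply/eqP; rewrite E; case: (d).
case=> /eqP->; rewrite -?mem_darts ?mem_rev_darts ?dD //.
by rewrite setUC.
Qed.

End Graph.

(** * Face tracing and the boundary of a 3-face *)

Section PlaneGraph.

Variable G : plane_graph.
Implicit Types (d e : G * G) (f g : face G).
Hypothesis degree_ge5 : forall v : G, 5 <= degree v.

Local Notation rotation := (@Defs.rot G).
Local Notation phi := (next_dart (@Defs.rot G)).
Local Notation rev := (@rev_dart G).

Definition left_face d : face G := dart_face d.1 d.2.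

Definition triangular d : bool := (d \in darts G) && kface 3 (left_face d).

Definition mid_dart d : bool := triangular d && triangular (rev d).

Lemma mem_boundary_darts d f :
  (d \in boundary_darts f) = (d \in darts G) && (left_face d == f).
Proof. by rewrite inE. Qed.

(** Otherwise the orbit of [u], which is the whole neighbourhood of [v], would have at most [k]
    elements, against degree at least 5. The case [k = 1] excludes facial walks of length 2, and
    [k = 2] excludes 3-faces glued along two edges at [v]. *)
Lemma rot_period (v u : G) k : adj v u -> 0 < k <= 2 -> (rotation v ^+ k)%g u <> u.
Proof.
move=> vu k2 E; have := degree_ge5 v.
rewrite /degree -(rot_cyclic vu) leqNgt => /negP[].
have: #|porbit (rotation v) u| <= k; last by lia.
have -> : porbit (rotation v) u = [set x in traject (rotation v) u k].
  apply/setP=> y; rewrite inE; apply/porbitP/trajectP => [[n ->]|[i _ ->]].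
    exists (n %% k); first by rewrite ltn_mod; case/andP: k2.
    rewrite -permX {1}(divn_eq n k) mulnC expgD expgM permM.
    suff -> : ((rotation v ^+ k) ^+ (n %/ k))%g u = u by [].
    by elim: (n %/ k) => [|m IH]; rewrite ?perm1 // expgS permM E.
  by exists i; rewrite permX.
by rewrite cardsE (leq_trans (card_size _)) ?size_traject.
Qed.

Lemma rot_neq (u v : G) : adj v u -> rotation v u <> u.
Proof. by move=> vu E; apply: (rot_period (k := 1) vu). Qed.

Lemma rot2_neq (u v : G) : adj v u -> rotation v (rotation v u) <> u.
Proof. by move=> vu E; apply: (rot_period (k := 2) vu) => //; rewrite permX. Qed.

Lemma next_dart_inj : injective phi.
Proof. by move=> [a b] [a' b'] [<- /perm_inj->]. Qed.

Lemma next_darts d : d \in darts G -> phi d \in darts G.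
Proof.
rewrite !mem_darts /= adj_sym => /rot_cyclic/setP/(_ (rotation d.2 d.1)).
by rewrite inE => <-; apply: (mem_porbit _ 1).
Qed.

Lemma left_face_next d : d \in darts G -> left_face (phi d) = left_face d.
Proof. by rewrite mem_darts => /dart_face_next. Qed.

Lemma next_dart_neq d : d \in darts G -> phi d <> d.
Proof. by case: d => a b; rewrite mem_darts /= => + [E _]; rewrite E adj_irrefl. Qed.

Lemma next2_dart_neq d : d \in darts G -> phi (phi d) <> d.
Proof.
by case: d => a b; rewrite mem_darts /= adj_sym => /rot_neq + [E _]; apply.
Qed.

Definition face_orbit d : {set G * G} := [set d; phi d; phi (phi d)].

Lemma card_face_orbit d : d \in darts G -> #|face_orbit d| = 3.
Proof.
move=> dD; rewrite /face_orbit setUC cardsU1 cards2 !inE.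
have /eqP/negPf n01 := next_dart_neq dD.
have /eqP/negPf n12 := next_dart_neq (next_darts dD).
by have /eqP/negPf n02 := next2_dart_neq dD; rewrite [d == _]eq_sym n01 n12 n02.
Qed.

Lemma face_orbit_sub d :
  d \in darts G -> face_orbit d \subset boundary_darts (left_face d).
Proof.
move=> dD; have D1 := next_darts dD; have D2 := next_darts D1.
apply/subsetP=> e; rewrite mem_boundary_darts !in_setU !in_set1 -orbA.
by case/or3P=> /eqP->; rewrite ?left_face_next // eqxx andbT.
Qed.

Lemma face_length_ge3 d : d \in darts G -> 3 <= face_length (left_face d).
Proof. by move=> dD; rewrite -(card_face_orbit dD) subset_leq_card ?face_orbit_sub. Qed.

Lemma triangular_darts d : triangular d -> d \in darts G.
Proof. by case/andP. Qed.

(** The orbit of [d] already supplies three distinct boundary darts, so a 3-face is bounded by a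
    single facial walk. *)
Lemma boundary_triangular d :
  triangular d -> boundary_darts (left_face d) = face_orbit d.
Proof.
case/andP=> dD /eqP f3; apply/esym/eqP.
by rewrite eqEcard face_orbit_sub //= card_face_orbit // -[#|_|]/(face_length _) f3.
Qed.

Lemma triangular_next d : triangular d -> triangular (phi d).
Proof.
by case/andP=> dD f3; rewrite /triangular next_darts ?left_face_next.
Qed.

Lemma next3_dart d : triangular d -> phi (phi (phi d)) = d.
Proof.
move=> td; have dD := triangular_darts td.
have D2 := next_darts (next_darts dD).
have: phi (phi (phi d)) \in face_orbit d.
  rewrite -boundary_triangular // mem_boundary_darts next_darts //.
  by rewrite !left_face_next ?eqxx // next_darts.
rewrite !inE -orbA => /or3P[] /eqP // /next_dart_inj E.
  by case: (next2_dart_neq dD).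
by move/next_dart_inj: E => E; case: (next_dart_neq dD).
Qed.

(** For a triangular [d], the third vertex of its 3-face. *)
Definition apex d : G := (phi d).2.

Lemma next2_dart_triangular d : triangular d -> phi (phi d) = (apex d, d.1).
Proof. by move=> td; have /(congr1 fst)/= E := next3_dart td; congr (_, _). Qed.

(** * Mid-edges and their diamonds *)

Lemma mid_dart_rev d : mid_dart (rev d) = mid_dart d.
Proof. by rewrite /mid_dart rev_dartK andbC. Qed.

Lemma mid_dart_triangular d : mid_dart d -> triangular d.
Proof. by case/andP. Qed.

(** The rotation at [d.2] takes [d.1] to [apex d], and [apex (rev d)] to [d.1]; a common apex would
    give it a 2-cycle. *)
Lemma mid_dart_apex d : mid_dart d -> apex d <> apex (rev d).
Proof.
move=> /andP[td trd] E.
have dD := triangular_darts td; move: (dD); rewrite mem_darts adj_sym.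
move=> /rot2_neq; apply; rewrite -[rotation d.2 d.1]/(apex d) E.
by have /(congr1 snd) := next3_dart trd; rewrite (next2_dart_triangular trd).
Qed.

Lemma mid_dart_uniq d :
  mid_dart d -> uniq [:: d.1; d.2; apex d; apex (rev d)].
Proof.
move=> md; have /andP[td trd] := md.
have neq (a b : G) : adj a b -> (a == b) = false.
  by move=> ab; apply/eqP=> E; move: ab; rewrite E adj_irrefl.
have adjs e : triangular e -> [/\ adj e.1 e.2, adj e.2 (apex e) & adj (apex e) e.1].
  move=> te; have eD := triangular_darts te; rewrite -!mem_darts.
  split.
  - by move: eD; rewrite mem_darts.
  - by have := next_darts eD; rewrite mem_darts.
  - by have := next_darts (next_darts eD); rewrite next2_dart_triangular // mem_darts.
have [/neq a1 /neq a2 a3] := adjs _ td.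
have [_ /= /neq b2 b3] := adjs _ trd.
rewrite adj_sym in a3; rewrite adj_sym in b3.
rewrite /= !inE a1 a2 b2 (neq _ _ a3) (neq _ _ b3) /=.
by rewrite andbT; apply/eqP/mid_dart_apex.
Qed.

Lemma boundary_edges_triangular d : triangular d ->
  boundary_edges (left_face d) =
    [set [set d.1; d.2]; [set d.2; apex d]; [set apex d; d.1]].
Proof.
move=> td; rewrite /boundary_edges boundary_triangular // /face_orbit.
by rewrite !imsetU !imset_set1 next2_dart_triangular.
Qed.

Lemma left_face_rev_neq d : mid_dart d -> left_face d != left_face (rev d).
Proof.
move=> md; have /andP[td trd] := md; apply/eqP=> E.
have: rev d \in face_orbit d.
  rewrite -boundary_triangular // mem_boundary_darts mem_rev_darts.
  by rewrite triangular_darts // E eqxx.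
have := mid_dart_uniq md; rewrite /= !inE !negb_or.
case/and4P=> /and3P[n12 n1a n1b] /andP[n2a n2b] _ _.
rewrite next2_dart_triangular // -orbA => /or3P[] /eqP E1.
- by case/eqP: n12; apply: (congr1 snd E1).
- by case/eqP: n1a; apply: (congr1 snd E1).
- by case/eqP: n2a; apply: (congr1 fst E1).
Qed.

Lemma mid_dart_common_edges d : mid_dart d ->
  common_edges (left_face d) (left_face (rev d)) = [set [set d.1; d.2]].
Proof.
move=> md; have /andP[td trd] := md.
have := mid_dart_uniq md; rewrite /= !inE !negb_or.
case/and4P=> /and3P[n12 n1a n1b] /andP[n2a n2b] nab _.
rewrite /common_edges !boundary_edges_triangular //=.
apply/setP=> s; rewrite in_setI in_set1; apply/andP/eqP=> [[sf sg]|->]; last first.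
  split; first by rewrite !in_setU !in_set1 eqxx.
  by rewrite setUC !in_setU !in_set1 eqxx.
(* The other two edges of the first triangle contain [apex d], which is not a vertex of the
   second. *)
have /negPf nas : apex d \notin s.
  rewrite eq_sym in n1a; rewrite eq_sym in n2a.
  move: sg; rewrite !in_setU !in_set1 -orbA.
  by case/or3P=> /eqP->; rewrite !inE negb_or ?n1a ?n2a ?nab.
move: sf; rewrite !in_setU !in_set1 -orbA => /or3P[] /eqP // sE.
  by rewrite sE set22 in nas.
by rewrite sE set21 in nas.
Qed.

Lemma mid_dart_face_adj d :
  mid_dart d -> face_adj (left_face d) (left_face (rev d)).
Proof.
move=> md; rewrite /face_adj left_face_rev_neq // mid_dart_common_edges //.
by apply/set0Pn; exists [set d.1; d.2]; rewrite inE.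
Qed.

Lemma mid_dart_diamond d :
  mid_dart d -> diamond (left_face d) (left_face (rev d)).
Proof.
move=> md; have /andP[/andP[_ k1] /andP[_ k2]] := md.
by rewrite /diamond k1 k2 mid_dart_face_adj //= mid_dart_common_edges // cards1.
Qed.

Lemma mid_dart_vertices d : mid_dart d ->
  diamond_vertices (left_face d) (left_face (rev d))
    = [set d.1; d.2; apex d; apex (rev d)].
Proof.
move=> /andP[td trd]; rewrite /diamond_vertices !boundary_edges_triangular //.
apply/setP=> x; apply/bigcupP/idP => [[s]|].
  by rewrite !inE -!orbA => /or4P[|||/or3P[]] /eqP->; rewrite !inE /=;
    case/orP=> ->; rewrite ?orbT.
rewrite !inE -!orbA => /or4P[] /eqP->.
- by exists [set d.1; d.2]; rewrite !inE eqxx.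
- by exists [set d.1; d.2]; rewrite !inE eqxx ?orbT.
- by exists [set d.2; apex d]; rewrite !inE eqxx ?orbT.
- by exists [set d.1; apex (rev d)]; rewrite !inE eqxx ?orbT.
Qed.

Lemma mid_dart_next_faces d : mid_dart d -> mid_dart (phi d) ->
  left_face (rev d) != left_face (rev (phi d)).
Proof.
move=> md mp; have /andP[td trd] := md; apply/eqP=> E.
have: rev (phi d) \in face_orbit (rev d).
  rewrite -boundary_triangular // mem_boundary_darts mem_rev_darts.
  by rewrite next_darts ?triangular_darts // E eqxx.
have := mid_dart_uniq md; rewrite /= !inE !negb_or.
case/and4P=> /and3P[n12 n1a n1b] /andP[n2a n2b] nab _.
rewrite next2_dart_triangular // -orbA => /or3P[] /eqP E1.
- by case/eqP: n12; apply/esym/(congr1 snd E1).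
- by case/eqP: n1a; apply/esym/(congr1 fst E1).
- by case/eqP: nab; apply: (congr1 fst E1).
Qed.

(** * Counting darts and faces *)

Lemma card_triangular : #|[set d | triangular d]| = 3 * #|[set f | @kface G 3 f]|.
Proof.
rewrite -sum1_card (partition_big left_face (mem [set f | kface 3 f])) /=.
  rewrite mulnC -sum_nat_const; apply: eq_bigr => f; rewrite inE => f3.
  rewrite -(eqP f3) /face_length -sum1_card; apply: eq_bigl => d.
  rewrite !inE /triangular -mem_darts; case: (d \in _) => //=.
  by rewrite andbC /left_face; case: eqP => //= ->.
by move=> d; rewrite !inE => /andP[].
Qed.

Lemma card_darts_faces : #|darts G| = \sum_(f : face G) face_length f.
Proof.
rewrite -sum1_card (partition_big left_face predT) //=.
apply: eq_bigr => f _; rewrite /face_length -sum1_card; apply: eq_bigl => d.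
by rewrite !inE.
Qed.

(** By connectedness a path of incidences joins [f] to [v]. Its first step reaches a vertex on [f],
    which is not isolated and so has a dart along [f]. The vertex [v] excludes the empty graph,
    whose only face has no dart. *)
Lemma face_has_dart (v : G) f : exists2 d, d \in darts G & left_face d = f.
Proof.
have sym : connect_sym (incidence (@dart_face G) (@vertex_face G)).
  by apply: sym_connect_sym => -[x|x] [y|y] //=; rewrite adj_sym.
have: connect (incidence (@dart_face G) (@vertex_face G)) (inr f) (inl v).
  have := plane_connected G; rewrite /n_comp_mem => /eqP.
  set e := incidence _ _ => /card1P[r rP].
  have root_r x : fingraph.root e x = r.
    by apply/eqP; have := rP (fingraph.root e x); rewrite !inE /= roots_root // => <-.
  by rewrite -root_connect // !root_r.
case/connectP=> -[|[w|g] p] //=; case/andP=> + _ _.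
rewrite /on_face inE; have := degree_ge5 w; case: eqP => [->//|_ _].
by case/existsP=> u /andP[wu /eqP fE]; exists (w, u); rewrite ?mem_darts.
Qed.

Lemma face_count (v : G) :
  4 * #|face G| <= #|darts G| + #|[set f | @kface G 3 f]|.
Proof.
rewrite card_darts_faces -[#|[set _ | _]|]sum1_card.
rewrite [X in _ + X]big_mkcond -big_split /= mulnC -sum_nat_const.
apply: leq_sum => f _; have [d dD <-] := face_has_dart v f.
by have := face_length_ge3 dD; rewrite inE /kface; case: eqP => ? /=; lia.
Qed.

(** Eliminating the number of facial walks from [plane_genus0] and [plane_tree] gives V + F = E + C
    + 1, with F faces and C components. *)
Lemma euler_count (v : G) :
  #|darts G| < 4 * #|G| + #|[set f | @kface G 3 f]|.
Proof.
have := face_count v; have := card_darts_edges G.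
by have := plane_genus0 G; have := plane_tree G; lia.
Qed.

Lemma card_mid_darts_ge :
  2 * #|[set d | triangular d]| <= #|darts G| + #|[set d | mid_dart d]|.
Proof.
have sub : [set d | mid_dart d] \subset [set d | triangular d].
  by apply/subsetP=> d; rewrite !inE => /andP[].
have subD : [set d | triangular d] \subset darts G.
  by apply/subsetP=> d; rewrite inE => /triangular_darts.
have cardT : #|[set d | triangular d]|
    = #|[set d | mid_dart d]| + #|[set d | triangular d] :\: [set d | mid_dart d]|.
  by rewrite -(cardsID [set d | mid_dart d]) (setIidPr sub).
have cardD : #|darts G|
    = #|[set d | triangular d]| + #|darts G :\: [set d | triangular d]|.
  by rewrite -(cardsID [set d | triangular d] (darts G)) (setIidPr subD).
suff: #|[set d | triangular d] :\: [set d | mid_dart d]|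
        <= #|darts G :\: [set d | triangular d]| by lia.
rewrite -(card_imset _ (@rev_dart_inj G)); apply/subset_leq_card.
apply/subsetP=> _ /imsetP[d + ->]; rewrite !in_setD mem_rev_darts !inE /mid_dart.
by case/andP=> + td; rewrite td /= => ->; have := triangular_darts td; rewrite inE.
Qed.

(** * At most two mid-edges on each 3-face *)

Hypothesis at_most_two : forall f : face G, kface 3 f ->
  #|[set g : face G | kface 3 g && face_adj f g]| <= 2.

(** Three mid-edges would put three pairwise distinct 3-faces across the sides of this one. *)
Lemma mid_dart_orbit d : triangular d ->
  mid_dart d + mid_dart (phi d) + mid_dart (phi (phi d)) <= 2.
Proof.
move=> td.
have [m0|_] := boolP (mid_dart d); last by do 2!case: (mid_dart _).
have [m1|_] := boolP (mid_dart (phi d)); last by case: (mid_dart _).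
have [m2|//] := boolP (mid_dart (phi (phi d))).
have /andP[dD f3] := td; have := at_most_two f3; rewrite leqNgt => /negP[].
set g0 := left_face (rev d); set g1 := left_face (rev (phi d)).
set g2 := left_face (rev (phi (phi d))).
have n01 : g0 != g1 by apply: mid_dart_next_faces.
have n12 : g1 != g2 by apply: mid_dart_next_faces.
have n20 : g2 != g0.
  by rewrite -[g0]/(left_face (rev d)) -(next3_dart td) mid_dart_next_faces ?next3_dart.
have card3 : #|[set g0; g1; g2]| = 3.
  by rewrite setUC cardsU1 cards2 !inE n01 negb_or n20 eq_sym n12.
rewrite -[X in X <= _]card3.
apply/subset_leq_card/subsetP=> g; rewrite !inE -orbA.
have nb e : mid_dart e -> left_face e = left_face d ->
    kface 3 (left_face (rev e)) && face_adj (left_face d) (left_face (rev e)).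
  by move=> me <-; rewrite mid_dart_face_adj // andbT; case/andP: me => _ /andP[].
have D1 := next_darts dD.
by case/or3P=> /eqP->; apply: nb; rewrite ?left_face_next.
Qed.

(** Face tracing permutes the triangular darts, with its square as inverse. *)
Lemma sum_next_dart (F : G * G -> nat) :
  \sum_(d | triangular d) F (phi d) = \sum_(d | triangular d) F d.
Proof.
rewrite [RHS](reindex_inj next_dart_inj) /=; apply: eq_bigl => d.
apply/idP/idP=> [/triangular_next //|tp].
have <- : phi (phi (phi d)) = d by apply: next_dart_inj; rewrite next3_dart.
by do 2!apply: triangular_next.
Qed.

Lemma card_mid_darts : #|[set d | mid_dart d]| = \sum_(d | triangular d) mid_dart d.
Proof.
rewrite -sum1_card [RHS]big_mkcond /= [LHS]big_mkcond; apply: eq_bigr => d _.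
by rewrite inE /mid_dart; case: (triangular d); case: (triangular _).
Qed.

Lemma card_mid_darts_le :
  3 * #|[set d | mid_dart d]| <= 2 * #|[set d | triangular d]|.
Proof.
have -> : 3 * #|[set d | mid_dart d]| = \sum_(d | triangular d)
    (mid_dart d + mid_dart (phi d) + mid_dart (phi (phi d))).
  rewrite !big_split /= (sum_next_dart (fun d => mid_dart (phi d) : nat)).
  by rewrite (sum_next_dart (fun d => mid_dart d : nat)) -card_mid_darts !mulSn addn0 addnA.
rewrite -[#|[set d | triangular d]|]sum1_card big_distrr /=.
under [leqRHS]eq_bigl => d do rewrite inE.
by apply: leq_sum => d td; rewrite muln1 mid_dart_orbit.
Qed.

(** * Charging diamonds to darts *)

(* Degrees 5, 6 and at least 7 have excess 0, 1 and 2, so four vertices of total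
   excess at most 1 are three of degree 5 and one of degree at most 6. *)
Definition excess (v : G) : nat := minn (degree v - 5) 2.

(* At most two sides of a 3-face are mid-edges: if the side of [d] and the side
   from [apex d] to [d.1] both are, then the remaining side is not, and its
   dart leaving [apex d] lies on no 3-face. *)
Definition apex_dart d : G * G :=
  if mid_dart (phi (phi d)) then rev (phi d) else phi (phi d).

Lemma apex_dart_source d : triangular d -> (apex_dart d).1 = apex d.
Proof.
by move=> td; rewrite /apex_dart; case: ifP => // _; rewrite next2_dart_triangular.
Qed.

Lemma apex_dart_triangular d : mid_dart d ->
  triangular (apex_dart d) = ~~ mid_dart (phi (phi d)).
Proof.
move=> md; have td := mid_dart_triangular md; rewrite /apex_dart.
case: ifP => m2; last by rewrite !triangular_next.
have := mid_dart_orbit td; rewrite md m2 /mid_dart triangular_next //=.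
by case: (triangular _).
Qed.

Lemma apex_dart_not_mid d : mid_dart d -> ~~ mid_dart (apex_dart d).
Proof.
move=> md; have := apex_dart_triangular md.
case E: (mid_dart (phi (phi d))) => /=.
  by rewrite /mid_dart => ->.
by rewrite /apex_dart E E.
Qed.

(** Whether the image is triangular reveals which branch of [apex_dart] was taken, and each branch
    is injective. *)
Lemma apex_dart_inj : {in mid_dart &, injective apex_dart}.
Proof.
move=> d e md me E; have := apex_dart_triangular md.
rewrite E apex_dart_triangular //.
move: E; rewrite /apex_dart; case: ifP => _; case: ifP => _ // E _.
  by apply/next_dart_inj/rev_dart_inj.
by do 2!apply: next_dart_inj.
Qed.

Lemma apex_dart_darts d : mid_dart d -> apex_dart d \in darts G.
Proof.
move=> /mid_dart_triangular td; rewrite /apex_dart; case: ifP => _.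
  by rewrite mem_rev_darts; apply/triangular_darts/triangular_next.
by do 2!apply: next_darts; apply: triangular_darts.
Qed.

Lemma sum_mid_darts_rev (F : G * G -> nat) :
  \sum_(d | mid_dart d) F (rev d) = \sum_(d | mid_dart d) F d.
Proof.
rewrite [RHS](reindex_inj (@rev_dart_inj G)) /=.
by apply: eq_bigl => d; rewrite mid_dart_rev.
Qed.

(** The terms in [d.1] are charged to the mid darts themselves, those in [apex d] to the darts
    [apex_dart d], which are distinct and not mid. *)
Lemma sum_apex_excess :
  \sum_(d | mid_dart d) (excess d.1 + excess (apex d))
    <= \sum_(v : G) degree v * excess v.
Proof.
rewrite -sum_darts_source [leqRHS](bigID mid_dart) /= big_split /= leq_add //.
  by rewrite leq_eqVlt; apply/orP; left; apply/eqP/eq_bigl => d;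
    rewrite andb_idl // => /mid_dart_triangular/triangular_darts.
under eq_bigr => d md do rewrite -apex_dart_source ?mid_dart_triangular //.
rewrite -(big_imset (fun e => excess e.1) apex_dart_inj) /=.
rewrite [leqLHS]big_mkcond [leqRHS]big_mkcond /=; apply: leq_sum => e _.
case: imsetP => // -[d md ->].
by rewrite apex_dart_darts // apex_dart_not_mid.
Qed.

Lemma sum_degree_excess :
  \sum_(v : G) degree v * excess v + 40 * #|G| <= 8 * #|darts G|.
Proof.
rewrite card_darts mulnC -sum_nat_const -big_split big_distrr /=.
(* For degree k and excess w, k w + 40 <= 8 k: this reads 40 <= 40 at k = 5, 46 <= 48 at k = 6, and
   2 k + 40 <= 8 k for k >= 7. *)
apply: leq_sum => v _; have := degree_ge5 v; rewrite /excess.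
case: (leqP (degree v) 5) => ?; first by nia.
by case: (leqP (degree v) 6) => ?; nia.
Qed.

Lemma exists_light_mid_dart (v : G) : exists2 d, mid_dart d &
  excess d.1 + excess d.2 + excess (apex d) + excess (apex (rev d)) <= 1.
Proof.
apply/exists_inP; apply: contraT; rewrite negb_exists_in => /forall_inP heavy.
(* The terms of [d] and [rev d] together weigh the four vertices of the diamond. *)
have: 2 * #|[set d | mid_dart d]|
    <= 2 * \sum_(d | mid_dart d) (excess d.1 + excess (apex d)).
  rewrite -sum1_card big_distrr /= [in leqRHS]mul2n -addnn.
  rewrite -{1}(sum_mid_darts_rev (fun d => excess d.1 + excess (apex d))).
  rewrite -big_split /=; under eq_bigl => d do rewrite inE.
  by apply: leq_sum => d /heavy; rewrite -ltnNge /=; lia.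
(* From 6 T - M <= A and M <= 2 T follows 4 T <= A, while 6 T - A <= M <= 8 A - 40 V and A < 4 V + T
   give A < 4 T. *)
have := sum_apex_excess; have := sum_degree_excess; have := euler_count v.
by have := card_mid_darts_ge; have := card_mid_darts_le; rewrite card_triangular; lia.
Qed.

End PlaneGraph.

Theorem theorem6 (G : plane_graph)
    (at_most_two : forall f : face G, kface 3 f ->
       #|[set g : face G | kface 3 g && face_adj f g]| <= 2)
    (min_degree_ge5 : 5 <= min_degree G) :
  exists f g : face G, diamond f g /\
    exists a b c d : G,
      [/\ uniq [:: a; b; c; d],
          diamond_vertices f g = [set a; b; c; d],
          [/\ degree a = 5, degree b = 5 & degree c = 5]
        & degree d <= 6].
Proof.
(* The unit [#|G|] of the minimum is also at least 5, so there is a vertex. *)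
have [/(leq_trans (isT : 0 < 5))/card_gt0P[v _] degs] := leq_bigminn min_degree_ge5.
have deg5 (u : G) : 5 <= degree u by apply: degs; rewrite mem_index_enum.
have [d md light] := exists_light_mid_dart deg5 at_most_two v.
exists (left_face d), (left_face (rev_dart d)).
split; first exact: mid_dart_diamond.
rewrite mid_dart_vertices //; have := mid_dart_uniq deg5 md; move: light.
move: (d.1) (d.2) (apex d) (apex (rev_dart d)) => a b x y light abxy.
have [a5 b5 x5 y5] := And4 (deg5 a) (deg5 b) (deg5 x) (deg5 y).
have perm s : perm_eq [:: a; b; x; y] s -> uniq s /\ [set a; b; x; y] = [set z in s].
  move=> ps; split; first by rewrite -(perm_uniq ps).
  by apply/setP=> z; rewrite !inE -(perm_mem ps) !inE -!orbA.
have set4 (p q r s : G) : [set z in [:: p; q; r; s]] = [set p; q; r; s].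
  by apply/setP=> z; rewrite !inE -!orbA.
have swap (p q r s : G) : perm_eq [:: a; b; x; y] [:: p; q; r; s] ->
    [/\ degree p = 5, degree q = 5 & degree r = 5] -> degree s <= 6 ->
    exists a' b' c' d' : G, [/\ uniq [:: a'; b'; c'; d'],
      [set a; b; x; y] = [set a'; b'; c'; d'],
      [/\ degree a' = 5, degree b' = 5 & degree c' = 5] & degree d' <= 6].
  by move=> /perm[u E]; rewrite set4 in E; exists p, q, r, s.
rewrite /excess in light.
(* At most one of the four degrees exceeds 5, and then it is 6; that vertex is moved to the last
   place. *)
case: (ltnP 5 (degree a)) => ha.
  apply: (swap b x y a); [|by split; lia|by lia].
  by rewrite (perm_catC [:: a] [:: b; x; y]).
case: (ltnP 5 (degree b)) => hb.
  apply: (swap a x y b); [|by split; lia|by lia].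
  by rewrite perm_cons (perm_catC [:: b] [:: x; y]).
case: (ltnP 5 (degree x)) => hx.
  apply: (swap a b y x); [|by split; lia|by lia].
  by rewrite !perm_cons (perm_catC [:: x] [:: y]).
by apply: (swap a b x y); [|split; lia|lia].
Qed.
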